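(* Let $r,s\in\mathbb N_0\cup\{-1\}$ and $u,v\in\mathbb N_0$ with $u\ge r$ and $v\ge s$. Let $\mathbf a=(a_1,\dots,a_{r+1})$, $\mathbf b=(b_1,\dots,b_u)$, $\mathbf c=(c_1,\dots,c_{s+1})$, $\mathbf d=(d_1,\dots,d_v)$ be tuples of nonzero complex numbers, and let $X,Y\in\mathbb C$ be such that ${}_{r+1}F_u(\mathbf a;\mathbf b;X)\,{}_{s+1}F_v(\mathbf c;\mathbf d;Y)$ is well defined: no $b_i$ or $d_j$ lies in $-\mathbb N_0$, $|X|<1$ if $u=r$, and $|Y|<1$ if $v=s$. (1) If moreover $X\neq0$ and no $a_i$ lies in $-\mathbb N_0$, then $${}_{r+1}F_u(\mathbf a;\mathbf b;X)\,{}_{s+1}F_v(\mathbf c;\mathbf d;Y)=\sum_{m=0}^\infty\frac{(\mathbf a)_m}{(\mathbf b)_m}\frac{X^m}{m!}\;{}_{s+u+2}F_{r+v+1}\left(-m,\mathbf c,1-m-\mathbf b;\ \mathbf d,1-m-\mathbf a;\ (-1)^{u-r}\frac YX\right).$$ (2) If moreover $Y\neq0$ and no $c_i$ lies in $-\mathbb N_0$, then $${}_{r+1}F_u(\mathbf a;\mathbf b;X)\,{}_{s+1}F_v(\mathbf c;\mathbf d;Y)=\sum_{m=0}^\infty\frac{(\mathbf c)_m}{(\mathbf d)_m}\frac{Y^m}{m!}\;{}_{r+v+2}F_{s+u+1}\left(-m,\mathbf a,1-m-\mathbf d;\ \mathbf b,1-m-\mathbf c;\ (-1)^{v-s}\frac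 XY\right).$$
   Context: $\mathbb N_0=\{0,1,2,\dots\}$. $(a)_k=a(a+1)\cdots(a+k-1)$, $(\mathbf a)_k=\prod_i(a_i)_k$, and ${}_RF_S(\mathbf A;\mathbf B;z)=\sum_{k\ge0}\frac{(\mathbf A)_k}{(\mathbf B)_k}\frac{z^k}{k!}$; if $-m$ with $m\in\mathbb N_0$ is a numerator parameter, the sum is over $0\le k\le m$. For a tuple $\mathbf b=(b_1,\dots,b_u)$, $1-m-\mathbf b$ is the tuple $(1-m-b_1,\dots,1-m-b_u)$. Empty products are $1$. *)

(* Defs.v *)
From mathcomp Require Export all_boot all_order all_algebra.
From mathcomp Require Export all_classical all_reals all_analysis.
From mathcomp Require Export complex.
Export Order.TTheory GRing.Theory Num.Theory.
Export numFieldNormedType.Exports.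
#[export] Set Implicit Arguments.
#[export] Unset Strict Implicit.
#[export] Unset Printing Implicit Defensive.
Global Open Scope classical_set_scope.
Global Open Scope ring_scope.

(* R[i] carries no topology of its own in the library; packaging it as a
   numClosedFieldType gives it the topology of its norm `|z|. *)
Definition cplx (R : realType) : numClosedFieldType := R[i]%C.

Section Hypergeometric.
Variable R : realType.
Local Notation C := (cplx R).
Implicit Types (x z : C) (A B : seq C) (k m n : nat).

Definition nonpos_int x : Prop := exists n, x = - n%:R.

Definition poch x k : C := \prod_(i < k) (x + i%:R).

Definition pochs A k : C := \prod_(x <- A) poch x k.

(* The summation range: k is excluded as soon as k > m for some numerator
   parameter -m. *)
Definition hyp_range A k : bool :=
  all (fun x => [forall j : 'I_k, x != - (j : nat)%:R]) A.

Definition hyp_term A B z k : C :=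
  if hyp_range A k then pochs A k / pochs B k * (z ^+ k / k`!%:R) else 0.

(* A terminating series has eventually constant partial sums, so the limit is
   then the finite sum. *)
Definition hypF A B z : C := limn (series (hyp_term A B z)).

(* The tuple 1 - m - b. *)
Definition refl_params m A : seq C := [seq 1 - m%:R - x | x <- A].

End Hypergeometric.

(* Main.v *)
From HB Require Import structures.
Require Import Defs.
From mathcomp Require Import ring lra zify.

(** Both expansions are the Cauchy product of the two hypergeometric series, with
each antidiagonal sum rewritten as a terminating hypergeometric function.

Write [A_m] and [C_k] for the terms of the series in [X] and in [Y].  The
Cauchy product is the sum over [m] of the sums over [k <= m] of
[A_(m - k) * C_k].  The factor [A_m] can be pulled out: since
[(1 - m - x)_k (x)_(m - k) = (-1)^k (x)_m], the quotient [A_(m - k) / A_m] is a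
quotient of Pochhammer symbols of length [k] at the parameters [-m], [1 - m - b]
and [1 - m - a], times [(X^-1)^k] and a sign that goes into the argument.  What is
left inside is the [k]-th term of the inner series ([hyp_term_refl]), and that
series stops at [k = m] because of the parameter [-m] ([hypF_terminating]).

Analytically, the ratio test shows that both series converge absolutely under the
given conditions on sizes and arguments ([hyp_term_summable]), and the Cauchy
product of absolutely convergent complex series converges to the product of their
sums ([cauchy_prod_cvg]).  Its error is dominated by the increment, from [n./2] to
[n], of the product of the partial sums of moduli ([cauchy_prod_defect]).

The second expansion is the first one with the roles of the two series exchanged. *)

(** * Pochhammer symbols and their reflection *)

Section Algebra.
Variable R : realType.
Local Notation C := (cplx R).
Implicit Types (x z X Y : C) (a b c d A B : seq C) (k m n : nat).

Lemma pochSr x k : poch x k.+1 = poch x k * (x + k%:R).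
Proof. by rewrite /poch big_ord_recr. Qed.

Lemma poch_neq0 x k : ~ nonpos_int x -> poch x k != 0.
Proof.
move=> xN; apply/prodf_neq0 => i _; apply/eqP => xi0; apply: xN.
by exists (i : nat); apply/eqP; rewrite -addr_eq0 xi0.
Qed.

Lemma pochs_neq0 A k : (forall x, x \in A -> ~ nonpos_int x) -> pochs A k != 0.
Proof.
move=> AN; rewrite prodf_seq_neq0; apply/allP => x /AN xN.
exact: poch_neq0.
Qed.

Lemma poch1 n : poch (1 : C) n = n`!%:R.
Proof.
elim: n => [|n IHn]; first by rewrite /poch big_ord0.
by rewrite pochSr IHn factS mulnC natrM -natr1 addrC.
Qed.

Lemma pochs_cons x A k : pochs (x :: A) k = poch x k * pochs A k.
Proof. exact: big_cons. Qed.

Lemma pochs_cat A B k : pochs (A ++ B) k = pochs A k * pochs B k.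
Proof. exact: big_cat. Qed.

(** Outside the range some numerator parameter is [-j] with [j < k], which makes
[pochs A k] vanish.  The right-hand side is then 0 even if [pochs B k] vanishes as
well, since [0 / 0 = 0]. *)
Lemma hyp_termE A B z k :
  hyp_term A B z k = pochs A k / pochs B k * (z ^+ k / k`!%:R).
Proof.
rewrite /hyp_term; case: ifPn => // /allPn[x xA].
rewrite negb_forall => /existsP[j]; rewrite negbK => /eqP xj.
suff -> : pochs A k = 0 by rewrite !mul0r.
apply/eqP; rewrite prodf_seq_eq0; apply/hasP; exists x => //=.
by apply/prodf_eq0; exists j => //; rewrite xj addNr.
Qed.

(** The factors of [poch (1 - m - x) k] are, up to sign, the last [k] of the [m]
factors of [poch x m], read backwards. *)
Lemma poch_refl x m k : (k <= m)%N ->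
  poch (1 - m%:R - x) k * poch x (m - k) = (-1) ^+ k * poch x m.
Proof.
elim: k => [|k IHk] km; first by rewrite /poch big_ord0 subn0.
have mk : (m - k = (m - k.+1).+1)%N by lia.
have := IHk (ltnW km).
rewrite mk !pochSr exprS natrB // -natr1 => IH.
rewrite -mulrA mulN1r mulNr -IH; ring.
Qed.

Lemma pochs_refl A m k : (k <= m)%N ->
  pochs (refl_params m A) k * pochs A (m - k) =
  (-1) ^+ (k * size A) * pochs A m.
Proof.
move=> km; elim: A => [|x A IHA] /=; first by rewrite /pochs !big_nil muln0 !mul1r.
rewrite !pochs_cons mulnS exprD.
by rewrite mulrACA IHA poch_refl // mulrACA.
Qed.

(** This is where the hypergeometric parameters on the right-hand side come from.
The quotient of the [(m - k)]-th by the [m]-th term of the series in [X] is a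
quotient of Pochhammer symbols of length [k] at the reflected parameters; the
parameter [-m] is the reflection of the parameter [1] hidden in the factorial.
Reflection costs one sign [(-1) ^+ k] per parameter, that is
[size a + size b + 1] of them, and these are absorbed into the argument.  The
conditions on [a] and [b] make all the cancelled symbols nonzero. *)
Lemma hyp_term_refl a b c d X Y m k : (k <= m)%N -> X != 0 ->
  (size a <= (size b).+1)%N ->
  (forall x, x \in a -> ~ nonpos_int x) ->
  (forall x, x \in b -> ~ nonpos_int x) ->
  pochs a m / pochs b m * (X ^+ m / m`!%:R) *
    hyp_term (- m%:R :: c ++ refl_params m b) (d ++ refl_params m a)
      ((-1) ^+ ((size b).+1 - size a) * (Y / X)) k =
  hyp_term a b X (m - k) * hyp_term c d Y k.
Proof.
move=> km X0 ab aN bN; rewrite !hyp_termE pochs_cons !pochs_cat.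
have := pochs_refl a km; have := pochs_refl b km; have := poch_refl 1 km.
(* [k`!] and [m`!] are the symbols at [1], whose reflection is [- m] *)
rewrite !poch1 (_ : 1 - m%:R - 1 = - m%:R :> C); last by ring.
have a0 := pochs_neq0 m aN; have a'0 := pochs_neq0 (m - k) aN.
have b0 := pochs_neq0 m bN; have b'0 := pochs_neq0 (m - k) bN.
have f0 n : n`!%:R != 0 :> C by rewrite pnatr_eq0 -lt0n fact_gt0.
have := f0 m; have := f0 (m - k)%N; have := f0 k; set fk : C := k`!%:R.
set fm : C := m`!%:R; set fmk : C := (m - k)`!%:R => fk0 fmk0 fm0 Em Eb Ea.
have sgn0 n : (-1) ^+ n != 0 :> C by rewrite signr_eq0.
have -> : poch (- m%:R : C) k = (-1) ^+ k * fm / fmk by rewrite -Em mulfK.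
have -> : pochs (refl_params m b) k =
    (-1) ^+ (k * size b) * pochs b m / pochs b (m - k) by rewrite -Eb mulfK.
have -> : pochs (refl_params m a) k =
    (-1) ^+ (k * size a) * pochs a m / pochs a (m - k) by rewrite -Ea mulfK.
have -> : X ^+ m = X ^+ (m - k) * X ^+ k by rewrite -exprD subnK.
rewrite !exprMn -exprM exprVn.
have Xk0 : X ^+ k != 0 by rewrite expf_neq0.
(* the exponents of -1 on the two sides differ by the even number
   [2 * k * ((size b).+1 - size a)] *)
have sgnE : (-1) ^+ k * (-1) ^+ (k * size b) *
    (-1) ^+ (((size b).+1 - size a) * k) = (-1) ^+ (k * size a) :> C.
  rewrite -!exprD -signr_odd -[RHS]signr_odd; congr (_ ^+ (nat_of_bool _)).
  rewrite (_ : _ + _ = (k * ((size b).+1 - size a)).*2 + k * size a)%N.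
    by rewrite oddD odd_double.
  by rewrite -addnn; nia.
(* [pochs d k] may vanish, so its inverse is kept as an atom *)
rewrite !invfM -sgnE; set D := (pochs d k)^-1; field.
by rewrite !sgn0 Xk0 a0 a'0 b0 b'0 fk0 fm0 fmk0.
Qed.

End Algebra.

(** * Absolutely convergent complex series *)

Definition cauchy_prod (S : pzRingType) (f g : nat -> S) (m : nat) : S :=
  \sum_(k < m.+1) f (m - k)%N * g k.

(** Both sides sum [f i * g j] over the triangle [i + j < n], once along its
diagonals and once along its rows. *)
Lemma series_cauchy_prod (S : pzRingType) (f g : nat -> S) (n : nat) :
  series (cauchy_prod f g) n =
  \sum_(i < n) \sum_(j < n | (i + j < n)%N) f i * g j.
Proof.
rewrite /series /= big_mkord /cauchy_prod.
have -> : \sum_(m < n) \sum_(k < m.+1) f (m - k)%N * g k =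
    \sum_(m < n) \sum_(k < n | (k <= m)%N) f (m - k)%N * g k.
  apply: eq_bigr => m _.
  by rewrite (big_ord_widen n (fun k => f (m - k)%N * g k)).
rewrite (exchange_big_dep xpredT) //= [RHS](exchange_big_dep xpredT) //=.
apply: eq_bigr => j _.
rewrite -(big_mkord (fun m => (j <= m)%N) (fun m => f (m - j)%N * g j)).
rewrite -(big_mkord (fun i => (i + j < n)%N) (fun i => f i * g j)).
rewrite (@big_cat_nat _ _ _ j) ?(ltnW (ltn_ord j)) //=.
rewrite big_nat_cond big_pred0; last first.
  by move=> i; lia.
rewrite add0r -[X in \sum_(X <= _ < _ | _) _]add0n big_addn.
rewrite (big_nat_widen 0 (n - j) n) ?leq_subr //.
apply: eq_big => [i|i _]; last by rewrite addnK.
by rewrite leq_addl ltn_subRL addnC.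
Qed.

Lemma cvg_half (T : ptopologicalType) (u : nat -> T) (l : T) :
  u @ \oo --> l -> (fun n => u n./2) @ \oo --> l.
Proof.
move=> ul; apply: cvg_comp ul => A [N _ NA]; exists N.*2 => // n /= nN.
by apply: NA => /=; lia.
Qed.

Section Analysis.
Variable R : realType.
Local Notation C := (cplx R).
Implicit Types (f g : nat -> C) (z : C).

(** The usual embedding of the reals, typed so as to land in the topological type
[cplx R]. *)
Definition cplx_of (t : R) : C := (t%:C)%C.
(** The modulus as a real number, so that the theory of real series applies to it;
the norm of [cplx R] takes its values in [cplx R] itself. *)
Definition cabs (z : C) : R := ComplexField.Normc.normc z.

HB.instance Definition _ := GRing.RMorphism.copy cplx_of (real_complex R).

Lemma norm_cabs z : `|z| = cplx_of (cabs z). Proof. by []. Qed.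

Lemma cabs_cplx_of (t : R) : cabs (cplx_of t) = `|t|.
Proof. by rewrite /cabs /cplx_of /= expr0n addr0 sqrtr_sqr. Qed.

Lemma lt_cplx_of (s t : R) : (cplx_of s < cplx_of t) = (s < t).
Proof. exact: ltcR. Qed.

Lemma le_cplx_of (s t : R) : (cplx_of s <= cplx_of t) = (s <= t).
Proof. exact: lecR. Qed.

Lemma cplx_of_gt0 (e : C) : 0 < e -> exists2 t : R, 0 < t & e = cplx_of t.
Proof.
move=> e0; exists (complex.Re e).
  by move: e0; rewrite ltcE => /andP[].
by rewrite /cplx_of [LHS]complexE (ger0_Im (ltW e0)) mulr0 addr0.
Qed.

Lemma cabsM z1 z2 : cabs (z1 * z2) = cabs z1 * cabs z2.
Proof. exact: ComplexField.Normc.normcM. Qed.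

Lemma cabs_ge0 z : 0 <= cabs z.
Proof. by rewrite -le_cplx_of -norm_cabs rmorph0. Qed.

Lemma cabs_sum I (r : seq I) (P : pred I) (F : I -> C) :
  cabs (\sum_(i <- r | P i) F i) <= \sum_(i <- r | P i) cabs (F i).
Proof.
rewrite -le_cplx_of rmorph_sum /=; exact: (ler_norm_sum r F P).
Qed.

Lemma cabs_Re z : `|complex.Re z| <= cabs z.
Proof. rewrite -le_cplx_of; exact: normc_ge_Re. Qed.

Lemma cabs_Im z : `|complex.Im z| <= cabs z.
Proof.
rewrite -normrN -ReiNIm (le_trans (cabs_Re _)) // cabsM.
suff -> : cabs 'i%C = 1 by rewrite mulr1.
by rewrite /cabs /= expr0n add0r expr1n sqrtr1.
Qed.

Lemma cvg_cplx_of (u : nat -> R) l :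
  u @ \oo --> l -> (fun n => cplx_of (u n)) @ \oo --> cplx_of l.
Proof.
move=> /cvgrPdist_lt ul; apply/cvgrPdist_lt => _ /cplx_of_gt0[e e0 ->].
near=> n.
rewrite -rmorphB norm_cabs lt_cplx_of cabs_cplx_of.
by near: n; apply: ul.
Unshelve. all: by end_near. Qed.

Definition abs_summable f := cvgn (series (fun n => cabs (f n))).

(** The completeness of the reals is used here: the real and the imaginary parts
are dominated by the moduli, and the limit is rebuilt from the two limits. *)
Lemma abs_summable_cvg f : abs_summable f -> cvgn (series f).
Proof.
move=> fs.
have part (p : C -> R) : (forall z, `|p z| <= cabs z) ->
    cvgn (series (fun n => p (f n))).
  move=> pf; apply: normed_cvg; apply: series_le_cvg fs => n /=.
  - exact: normr_ge0.
  - exact: cabs_ge0.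
  - exact: pf.
have /cvg_ex[lr /cvg_cplx_of cRe] := part _ cabs_Re.
have /cvg_ex[li /cvg_cplx_of cIm] := part _ cabs_Im.
apply/cvg_ex; exists (cplx_of lr + ('i%C : C) * cplx_of li).
apply: cvg_trans (cvgD cRe (cvgM (cvg_cst ('i%C : C)) cIm)).
apply: near_eq_cvg; near=> n.
rewrite fctE /series /= !rmorph_sum mulr_sumr -big_split /=.
by apply: eq_bigr => k _; rewrite [RHS]complexE.
Unshelve. all: by end_near. Qed.

(** The product of the partial sums misses the triangle [i + j < n] by the terms
with [i, j < n <= i + j].  None of these has both [i] and [j] below [n./2], so
their moduli are bounded by the sum over the square of side [n] minus the
square of side [n./2], a quantity that tends to 0 for absolutely summable
families. *)
Lemma cauchy_prod_defect f g n :
  cabs (series f n * series g n - series (cauchy_prod f g) n) <=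
  series (fun i => cabs (f i)) n * series (fun j => cabs (g j)) n -
  series (fun i => cabs (f i)) n./2 * series (fun j => cabs (g j)) n./2.
Proof.
rewrite series_cauchy_prod /series /= !big_mkord.
rewrite !big_distrlr /= -sumrB.
have hn : (n./2 <= n)%N by lia.
rewrite [X in _ <= _ - X](_ : _ = \sum_(i < n) \sum_(j < n)
   if ((i < n./2) && (j < n./2))%N then cabs (f i) * cabs (g j) else 0).
  rewrite -sumrB (le_trans (cabs_sum _ _ _)) //; apply: ler_sum => i _.
  rewrite -sumrB [X in cabs (_ - X)]big_mkcond -sumrB.
  rewrite (le_trans (cabs_sum _ _ _)) //; apply: ler_sum => j _.
  have nn : 0 <= cabs (f i) * cabs (g j) by rewrite mulr_ge0 ?cabs_ge0.
  have c0 : cabs 0 = 0 by exact: ComplexField.Normc.normc0.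
  case: ifPn => ij; first by rewrite subrr c0; case: ifP; rewrite ?subrr ?subr0.
  rewrite subr0 cabsM ifF ?subr0 //; lia.
rewrite (big_ord_widen n (fun i => \sum_(j < n./2) cabs (f i) * cabs (g j))) //.
rewrite big_mkcond; apply: eq_bigr => i _; case: ifP => _ /=.
  rewrite (big_ord_widen n (fun j => cabs (f i) * cabs (g j))) //.
  by rewrite big_mkcond.
by rewrite big1.
Qed.

Theorem cauchy_prod_cvg f g : abs_summable f -> abs_summable g ->
  series (cauchy_prod f g) @ \oo --> limn (series f) * limn (series g).
Proof.
move=> fs gs.
set nf := series (fun i => cabs (f i)); set ng := series (fun j => cabs (g j)).
have fg : series f \* series g @ \oo --> limn (series f) * limn (series g).
  by apply: cvgM; apply: abs_summable_cvg.
have P : nf \* ng @ \oo --> limn nf * limn ng by exact: cvgM.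
have /(_ _)/cvg_cplx_of := cvgB P (cvg_half P).
rewrite subrr rmorph0 => D.
rewrite -[X in _ --> X]subr0.
suff E : (fun n => series f n * series g n - series (cauchy_prod f g) n) @ \oo
    --> (0 : C).
  apply: cvg_trans (cvgB fg E); apply: near_eq_cvg; near=> n => /=.
  by rewrite /= opprB addrC subrK.
apply/cvgrPdist_lt => e e0; move/cvgrPdist_lt/(_ e e0): D; apply: filterS => n.
rewrite /= !sub0r !normrN; apply: le_lt_trans.
rewrite !norm_cabs le_cplx_of (le_trans (cauchy_prod_defect _ _ _)) //.
by rewrite cabs_cplx_of ler_norm.
Unshelve. all: by end_near. Qed.

(** The ratios are given by a recurrence because the terms of a terminating series
vanish from some point on, where quotients would say nothing.  Past some rank the
terms are dominated by a geometric sequence of ratio strictly between [cabs l]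
and 1. *)
Lemma ratio_test f (rho : nat -> C) (l : C) :
  (forall n, f n.+1 = rho n * f n) -> rho @ \oo --> l -> `|l| < 1 ->
  abs_summable f.
Proof.
move=> frho rl; rewrite norm_cabs -(rmorph1 cplx_of) lt_cplx_of => l1.
have [q lq q1] : exists2 q, cabs l < q & q < 1.
  by exists ((cabs l + 1) / 2); [rewrite ltr_pdivlMr|rewrite ltr_pdivrMr]; lra.
have q0 : 0 <= q := le_trans (cabs_ge0 l) (ltW lq).
have : \forall n \near \oo, `|rho n| < cplx_of q.
  by apply: cvgr_norm_lt rl _ _; rewrite norm_cabs lt_cplx_of.
case=> N _ HN.
have bound k : cabs (f (k + N)%N) <= geometric (cabs (f N)) q k.
  elim: k => [|k IHk]; first by rewrite /= expr0 mulr1.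
  rewrite addSn frho cabsM /= exprS mulrCA ler_pM ?cabs_ge0 //.
  have := HN (k + N)%N (leq_addl _ _); rewrite /= norm_cabs lt_cplx_of.
  exact: ltW.
have geo : cvgn (series (fun k => cabs (f (k + N)%N))).
  apply: (series_le_cvg _ _ bound (is_cvg_geometric_series _)) => [n|n|].
  - exact: cabs_ge0.
  - by rewrite geometric_ge0 ?cabs_ge0.
  - by rewrite ger0_norm.
rewrite /abs_summable; set u := fun n => cabs (f n).
have /cvg_ex[L uL] := geo.
apply/cvg_ex; exists (series u N + L).
rewrite -(cvg_shiftn N); apply: cvg_trans (cvgD (cvg_cst (series u N)) uL).
apply: near_eq_cvg; near=> n.
rewrite /= /cst series_addn.
by rewrite -[X in _ + \sum_(X <= _ < _) _]add0n big_addn addnK.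
Unshelve. all: by end_near. Qed.

End Analysis.

(** * Convergence of hypergeometric series and their products *)

Section HypergeometricSeries.
Variable R : realType.
Local Notation C := (cplx R).
Implicit Types (x y z X Y : C) (a b c d A B : seq C) (k m n : nat).

Lemma cvg_succ_inv : (fun k => k.+1%:R^-1 : C) @ \oo --> (0 : C).
Proof.
rewrite -(rmorph0 (@cplx_of R)).
apply: cvg_trans (cvg_cplx_of (@cvg_harmonic R)); apply: near_eq_cvg.
by near=> n; rewrite /= fmorphV rmorph_nat.
Unshelve. all: by end_near. Qed.

(** Comparing a shift [x + k] with [k + 1] reduces all the limits below to that of
the harmonic sequence. *)
Lemma cvg_shift_div_succ x :
  (fun k => (x + k%:R) / k.+1%:R : C) @ \oo --> (1 : C).
Proof.
suff L : (fun k => 1 + (x - 1) * k.+1%:R^-1 : C) @ \oo --> 1 + (x - 1) * 0.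
  rewrite mulr0 addr0 in L; apply: cvg_trans L; apply: near_eq_cvg.
  near=> n; have n0 : n.+1%:R != 0 :> C by rewrite pnatr_eq0.
  apply: (mulIf n0); rewrite divfK // mulrDl divfK // -natr1; ring.
by apply: cvgD; [exact: cvg_cst|apply: cvgM cvg_succ_inv; exact: cvg_cst].
Unshelve. all: by end_near. Qed.

Lemma cvg_shift_inv y : (fun k => (y + k%:R)^-1 : C) @ \oo --> (0 : C).
Proof.
suff L : (fun k => ((y + k%:R) / k.+1%:R)^-1 * k.+1%:R^-1 : C) @ \oo -->
    (1 : C)^-1 * 0.
  rewrite mulr0 in L; apply: cvg_trans L; apply: near_eq_cvg.
  by near=> n; rewrite invfM invrK mulfK // pnatr_eq0.
apply: cvgM cvg_succ_inv; apply: cvgV; first exact: oner_neq0.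
exact: cvg_shift_div_succ.
Unshelve. all: by end_near. Qed.

Lemma cvg_shift_div x y : (fun k => (x + k%:R) / (y + k%:R) : C) @ \oo --> (1 : C).
Proof.
suff L : (fun k => (x + k%:R) / k.+1%:R * ((y + k%:R) / k.+1%:R)^-1 : C) @ \oo
    --> 1 * (1 : C)^-1.
  rewrite mul1r invr1 in L; apply: cvg_trans L; apply: near_eq_cvg.
  by near=> n; rewrite invfM invrK mulrACA mulVf ?mulr1 // pnatr_eq0.
apply: cvgM; first exact: cvg_shift_div_succ.
by apply: cvgV; [exact: oner_neq0|exact: cvg_shift_div_succ].
Unshelve. all: by end_near. Qed.

(** A numerator factor paired with a denominator factor has a quotient that tends
to 1, and a denominator factor without a partner contributes a limit 0. *)
Lemma cvg_shift_ratio A B : (size A <= size B)%N ->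
  (fun k => \prod_(x <- A) (x + k%:R) / \prod_(y <- B) (y + k%:R) : C)
    @ \oo --> ((size A == size B)%:R : C).
Proof.
elim: B A => [|y B IHB] [|x A] // AB.
- rewrite (_ : (fun k => _) = (fun=> 1)); first exact: cvg_cst.
  by apply/funext => k; rewrite !big_nil divr1.
- rewrite (_ : (fun k => _) = (fun k => (y + k%:R)^-1 *
    (\prod_(x <- [::]) (x + k%:R) / \prod_(y <- B) (y + k%:R)))); last first.
    by apply/funext => k; rewrite big_cons invfM mulrCA.
  rewrite -[X in _ --> X](mul0r ((size ([::] : seq C) == size B)%:R : C)).
  by apply: cvgM; [exact: cvg_shift_inv|exact: IHB].
- rewrite (_ : (fun k => _) = (fun k => (x + k%:R) / (y + k%:R) *
    (\prod_(x <- A) (x + k%:R) / \prod_(y <- B) (y + k%:R)))); last first.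
    by apply/funext => k; rewrite !big_cons invfM mulrACA.
  rewrite -[X in _ --> X]mul1r.
  by apply: cvgM; [exact: cvg_shift_div|exact: IHB].
Qed.

(** The ratio of consecutive terms is a quotient of products of shifted parameters
times [z], the factorial counting as one more denominator parameter [1].  It
tends to [z] if there are as many numerator as denominator parameters, and to 0
if there are fewer. *)
Lemma hyp_term_summable A B z : (size A <= (size B).+1)%N ->
  (size A = (size B).+1 -> `|z| < 1) -> abs_summable (hyp_term A B z).
Proof.
move=> AB z1.
pose rho k : C := \prod_(x <- A) (x + k%:R) / \prod_(y <- 1 :: B) (y + k%:R) * z.
apply: (@ratio_test _ _ rho ((size A == (size B).+1)%:R * z)).
- move=> k; rewrite !hyp_termE /rho.
  have pS D : pochs D k.+1 = pochs D k * \prod_(x <- D) (x + k%:R).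
    by rewrite -big_split; apply: eq_bigr => x _; rewrite pochSr.
  rewrite !pS big_cons factS natrM -natr1 exprS !invfM (addrC 1); ring.
- by apply: cvgM (cvg_cst _); apply: (@cvg_shift_ratio A (1 :: B)).
- by case: eqP => [/z1|_]; rewrite ?mul1r // mul0r normr0.
Qed.

Lemma hypF_terminating A B z m :
  hypF (- m%:R :: A) B z = \sum_(k < m.+1) hyp_term (- m%:R :: A) B z k.
Proof.
apply: lim_near_cst; first exact: norm_hausdorff.
near=> n; have mn : (m.+1 <= n)%N by near: n; exact: nbhs_infty_ge.
rewrite /series /= -(big_mkord xpredT (hyp_term (- m%:R :: A) B z)).
rewrite (@big_cat_nat _ _ _ m.+1) //=.
rewrite [X in _ + X]big_nat_cond [X in _ + X]big1 ?addr0 //.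
move=> k /andP[/andP[mk _] _]; rewrite /hyp_term ifF //= /hyp_range /=.
by apply/negbTE; rewrite negb_and negb_forall; apply/orP; left;
  apply/existsP; exists (Ordinal mk); rewrite negbK.
Unshelve. all: by end_near. Qed.

(** By [hyp_term_refl] the series on the left is the Cauchy product of the two
hypergeometric series, written with the sum over [k] as a terminating
hypergeometric function. *)
Theorem hypF_mul_expansion a b c d X Y :
  (size a <= (size b).+1)%N -> (size c <= (size d).+1)%N ->
  (size a = (size b).+1 -> `|X| < 1) -> (size c = (size d).+1 -> `|Y| < 1) ->
  X != 0 ->
  (forall x, x \in a -> ~ nonpos_int x) ->
  (forall x, x \in b -> ~ nonpos_int x) ->
  series (fun m =>
    pochs a m / pochs b m * (X ^+ m / m`!%:R) *
    hypF (- m%:R :: c ++ refl_params m b) (d ++ refl_params m a)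
      ((-1) ^+ ((size b).+1 - size a) * (Y / X)))
  @ \oo --> hypF a b X * hypF c d Y.
Proof.
move=> ab cd X1 Y1 X0 aN bN.
have -> : (fun m => pochs a m / pochs b m * (X ^+ m / m`!%:R) *
    hypF (- m%:R :: c ++ refl_params m b) (d ++ refl_params m a)
      ((-1) ^+ ((size b).+1 - size a) * (Y / X))) =
    cauchy_prod (hyp_term a b X) (hyp_term c d Y).
  apply/funext => m; rewrite hypF_terminating mulr_sumr.
  apply: eq_bigr => -[k /= km] _; exact: hyp_term_refl.
by apply: cauchy_prod_cvg; exact: hyp_term_summable.
Qed.

End HypergeometricSeries.

Theorem theorem5p32 (R : realType) (r s : int) (u v : nat)
  (a b c d : seq (cplx R)) (X Y : cplx R) :
  -1 <= r -> -1 <= s -> r <= u%:Z -> s <= v%:Z ->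
  (size a)%:Z = r + 1 -> size b = u -> (size c)%:Z = s + 1 -> size d = v ->
  (forall x, x \in a ++ b ++ c ++ d -> x != 0) ->
  (forall x, x \in b ++ d -> ~ nonpos_int x) ->
  (u%:Z = r -> `|X| < 1) ->
  (v%:Z = s -> `|Y| < 1) ->
  (X != 0 -> (forall x, x \in a -> ~ nonpos_int x) ->
    series (fun m : nat =>
      pochs a m / pochs b m * (X ^+ m / m`!%:R) *
      hypF (- m%:R :: c ++ refl_params m b) (d ++ refl_params m a)
           ((-1) ^ (u%:Z - r) * (Y / X)))
    @ \oo --> hypF a b X * hypF c d Y)
  /\
  (Y != 0 -> (forall x, x \in c -> ~ nonpos_int x) ->
    series (fun m : nat =>
      pochs c m / pochs d m * (Y ^+ m / m`!%:R) *
      hypF (- m%:R :: a ++ refl_params m d) (b ++ refl_params m c)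
           ((-1) ^ (v%:Z - s) * (X / Y)))
    @ \oo --> hypF a b X * hypF c d Y).
Proof.
move=> _ _ ru sv sa sb sc sd _ bdN X1 Y1.
have ab : (size a <= (size b).+1)%N by lia.
have cd : (size c <= (size d).+1)%N by lia.
have X1' : size a = (size b).+1 -> `|X| < 1 by move=> ?; apply: X1; lia.
have Y1' : size c = (size d).+1 -> `|Y| < 1 by move=> ?; apply: Y1; lia.
have -> : u%:Z - r = ((size b).+1 - size a)%N by lia.
have -> : v%:Z - s = ((size d).+1 - size c)%N by lia.
split=> [X0 aN|Y0 cN].
  by apply: hypF_mul_expansion => // x xb; apply: bdN; rewrite mem_cat xb.
rewrite [hypF a b X * _]mulrC.
by apply: hypF_mul_expansion => // x xd; apply: bdN; rewrite mem_cat xd orbT.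
Qed.
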